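(* Let $(\overline{x},\overline{\lambda})$ be a KKT point of the unperturbed problem, i.e. $(\overline{x},\overline{\lambda})\in\mathcal{S}_{\rm KKT}(0,0)$, and suppose that $\mathcal{M}(\overline{x},0,0)\neq\{\overline{\lambda}\}$. Then $\mathcal{S}_{\rm KKT}$ has the strong calmness at the origin for $(\overline{x},\overline{\lambda})$ if and only if $\mathcal{X}_{\rm KKT}$ has the pseudo-isolated calmness at the origin for $\overline{x}$ (with respect to $\overline{\lambda}$) and $\mathcal{M}$ is calm at $(\overline{x},0,0)$ for $\overline{\lambda}$.
   Context: Setting. $\mathbb{X},\mathbb{Y}$ are finite dimensional real vector spaces with inner product $\langle\cdot,\cdot\rangle$ and induced norm $\|\cdot\|$; $f:\mathbb{X}\to\mathbb{R}$ and $g:\mathbb{X}\to\mathbb{Y}$ are twice continuously differentiable; $\mathcal{K}\subseteq\mathbb{Y}$ is a nonempty closed convex set which is $C^2$-cone reducible: at every $\overline{y}\in\mathcal{K}$ there exist an open neighborhood $\mathcal{Y}$ of $\overline{y}$, a pointed closed convex cone $D$ in a finite dimensional space $\mathbb{Z}$, and a twice continuously differentiable $\Xi:\mathcal{Y}\to\mathbb{Z}$ with $\Xi(\overline{y})=0$, $\Xi'(\overline{y}):\mathbb{Y}\to\mathbb{Z}$ onto, and $\mathcal{K}\cap\mathcal{Y}=\{y\in\mathcal{Y}\mid\Xi(y)\in D\}$. The perturbed problem with parameter $(a,b)\in\mathbb{X}\times\mathbb{Y}$ is $\min_{x\in\mathbb{X}}\{f(x)-\langle a,x\rangle : g(x)-b\in\mathcal{K}\}$;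 the unperturbed problem has $(a,b)=(0,0)$. Notation. $h'(x)$ is the derivative of $h$ at $x$ and $\nabla h(x)$ its adjoint. $L(x,\lambda):=f(x)+\langle\lambda,g(x)\rangle$, so $\nabla_xL(x,\lambda)=\nabla f(x)+\nabla g(x)\lambda$. $\mathcal{N}_{\mathcal{K}}$ is the normal cone of convex analysis, and $\mathbb{B}_{\delta}(z)$ the closed ball of radius $\delta$ centered at $z$. KKT mappings. $\mathcal{S}_{\rm KKT}(a,b):=\{(x,\lambda)\in\mathbb{X}\times\mathbb{Y}\mid\nabla_xL(x,\lambda)=a,\ \lambda\in\mathcal{N}_{\mathcal{K}}(g(x)-b)\}$; $\mathcal{X}_{\rm KKT}(a,b):=\{x\in\mathbb{X}\mid\exists\lambda\in\mathbb{Y},\ (x,\lambda)\in\mathcal{S}_{\rm KKT}(a,b)\}$; $\mathcal{M}(x,a,b):=\{\lambda\in\mathbb{Y}\mid(x,\lambda)\in\mathcal{S}_{\rm KKT}(a,b)\}$. Strong calmness. For $\mathcal{M}(\overline{x},0,0)\neq\{\overline{\lambda}\}$, $\mathcal{S}_{\rm KKT}$ has the strong calmness at the origin for $(\overline{x},\overline{\lambda})$ if there exist $\delta,\varepsilon,\kappa>0$ such that for any $(a,b)\in\mathbb{B}_{\delta}((0,0))$ and any $(x,\lambda)\in\mathcal{S}_{\rm KKT}(a,b)\cap\mathbb{B}_{\varepsilon}((\overline{x},\overline{\lambda}))$, $\|x-\overline{x}\|+{\rm dist}(\lambda,\mathcal{M}(\overline{x},0,0))\le\kappa\|(a,b)\|$.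 Pseudo-isolated calmness. For $\overline{\lambda}\in\mathcal{M}(\overline{x},0,0)$, $\mathcal{X}_{\rm KKT}$ has the pseudo-isolated calmness at the origin for $\overline{x}$ (the multiplier $\overline{\lambda}$ being fixed) if there exist $\varepsilon,\delta,\kappa>0$ such that for any $(a,b)$ with $\|(a,b)\|\le\delta$ and any $(x,\lambda)\in\mathcal{S}_{\rm KKT}(a,b)\cap\mathbb{B}_{\varepsilon}((\overline{x},\overline{\lambda}))$, $\|x-\overline{x}\|\le\kappa\|(a,b)\|$. Calmness. A multifunction $\mathcal{F}:\mathbb{Z}\rightrightarrows\mathbb{W}$ is calm at $\overline{z}$ for $\overline{w}\in\mathcal{F}(\overline{z})$ if there exist $\kappa,\varepsilon,\delta>0$ such that $\mathcal{F}(z)\cap\mathbb{B}_{\delta}(\overline{w})\subseteq\mathcal{F}(\overline{z})+\kappa\|z-\overline{z}\|\mathbb{B}_{\mathbb{W}}$ for all $z\in\mathbb{B}_{\varepsilon}(\overline{z})$, where $\mathbb{B}_{\mathbb{W}}$ is the closed unit ball of $\mathbb{W}$. *)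

(* Defs.v *)
From HB Require Import structures.
From mathcomp Require Import all_boot all_order all_algebra.
From mathcomp Require Import ring.
From mathcomp Require Import all_classical all_reals all_analysis.
Import Order.TTheory GRing.Theory Num.Theory.
Import numFieldNormedType.Exports.

Set Implicit Arguments.
Unset Strict Implicit.
Unset Printing Implicit Defensive.

Local Open Scope classical_set_scope.
Local Open Scope ring_scope.

Definition finite_dimensional (R : realType) (V : lmodType R) : Prop :=
  exists (n : nat) (e : 'I_n -> V), forall v : V,
    exists c : 'I_n -> R, v = \sum_(i < n) c i *: e i.

Notation inner_product V := {dot V for (@idfun _)}.

Definition dnorm (R : realType) (V : lmodType R) (ip : inner_product V) (v : V)
  : R := Num.sqrt (ip v v).

Definition norm_induced_by (R : realType) (V : normedModType R)
  (ip : inner_product V) : Prop := forall v : V, `|v| = dnorm ip v.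

(* The norm that the library puts on V * W is the max norm; the norm of the
   product inner product space is [dnorm (prod_dot ipV ipW)]. *)
Section prod_dot.
Context {R : realType} {V W : lmodType R}.
Variables (ipV : inner_product V) (ipW : inner_product W).

Definition prod_dot (p q : V * W) : R := ipV p.1 q.1 + ipW p.2 q.2.

Let prod_dot_bilinear : bilinear_for *%R (idfun \; *%R) prod_dot.
Proof.
split=> [p|p] c q r; rewrite /prod_dot /=.
  by rewrite !linearPl /= addrACA mulrDr.
by rewrite !linearPr /= addrACA mulrDr.
Qed.

HB.instance Definition _ :=
  bilinear_isBilinear.Build R (V * W)%type (V * W)%type R *%R (idfun \; *%R)
    prod_dot prod_dot_bilinear.

Let prod_dot_sym (p q : V * W) :
  prod_dot p q = (-1) ^+ false * idfun (prod_dot q p).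
Proof.
by rewrite /prod_dot expr0 mul1r /= [ipV _ _]hermC [ipW _ _]hermC !expr0 !mul1r.
Qed.

HB.instance Definition _ :=
  isHermitianSesquilinear.Build R (V * W)%type false idfun prod_dot prod_dot_sym.

Let prod_dot_gt0 (p : V * W) : p != 0 -> 0 < prod_dot p p.
Proof.
case: p => v w; rewrite -[0]/(0, 0) xpair_eqE negb_and /prod_dot /=.
have ge0 (E : lmodType R) (ip : inner_product E) e : 0 <= ip e e.
  have [->|e0] := eqVneq e 0; first by rewrite linear0r.
  exact/ltW/neq0_dnorm_gt0.
by case/orP => n0; [apply: ltr_wpDr|apply: ltr_wpDl] => //;
  exact: neq0_dnorm_gt0.
Qed.

HB.instance Definition _ :=
  isDotProduct.Build R (V * W)%type prod_dot prod_dot_gt0.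

End prod_dot.

Section metric.
Context {R : realType} {V : lmodType R}.
Variable ip : inner_product V.

Definition cball (v : V) (r : R) : set V := [set w | dnorm ip (w - v) <= r].

(* Infimum over the reals: meaningful for nonempty A only. *)
Definition dist (v : V) (A : set V) : R := inf [set dnorm ip (v - w) | w in A].

Definition normal_cone (K : set V) (y : V) : set V :=
  [set v | K y /\ forall z, K z -> ip v (z - y) <= 0].

End metric.

Definition calm (R : realType) (V W : lmodType R)
    (ipV : inner_product V) (ipW : inner_product W)
    (F : V -> set W) (z0 : V) (w0 : W) : Prop :=
  exists kappa eps delta : R, [/\ 0 < kappa, 0 < eps, 0 < delta &
    forall z, cball ipV z0 eps z ->
      F z `&` cball ipW w0 delta `<=`
      [set w + (kappa * dnorm ipV (z - z0)) *: e
         | w in F z0 & e in cball ipW 0 1]].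

(* In finite dimension the topology of the space of linear maps is the topology
   of pointwise convergence, so continuity or differentiability of the map
   y |-> 'd h y amounts to that of y |-> 'd h y u for every direction u. *)
Definition C1_on (R : realType) (V W : normedModType R) (U : set V)
    (h : V -> W) : Prop :=
  forall x, U x -> differentiable h x /\
    forall u, {for x, continuous (fun y => 'd h y u)}.

Definition C2_on (R : realType) (V W : normedModType R) (U : set V)
    (h : V -> W) : Prop :=
  C1_on U h /\ forall u, C1_on U (fun y => 'd h y u).

Definition convex_cone (R : realType) (Z : lmodType R) (D : set Z) : Prop :=
  [/\ D 0, forall (t : R) z, 0 <= t -> D z -> D (t *: z) & convex_set D].

Definition pointed (R : realType) (Z : lmodType R) (D : set Z) : Prop :=
  forall z, D z -> D (- z) -> z = 0.

Definition C2_cone_reducible_at (R : realType) (Y : normedModType R)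
    (K : set Y) (y0 : Y) : Prop :=
  exists (U : set Y) (Z : normedModType R) (D : set Z) (Xi : Y -> Z),
    [/\ open U /\ U y0,
        finite_dimensional Z,
        [/\ closed D, convex_cone D & pointed D],
        [/\ C2_on U Xi, Xi y0 = 0 & range ('d Xi y0) = setT] &
        K `&` U = U `&` [set y | D (Xi y)]].

Definition C2_cone_reducible (R : realType) (Y : normedModType R)
    (K : set Y) : Prop :=
  forall y, K y -> C2_cone_reducible_at K y.

Section gradient.
Context {R : realType} {V W : normedModType R}.
Variables (ipV : inner_product V) (ipW : inner_product W).

Definition adjoint (A : V -> W) (w : W) : V :=
  get [set v | forall u, ipV v u = ipW w (A u)].

Definition nabla (h : V -> W) (x : V) : W -> V := adjoint ('d h x).

Definition grad (h : V -> R) (x : V) : V :=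
  get [set v | forall u, ipV v u = 'd h x u].

Hypothesis finV : finite_dimensional V.

(* By Riesz representation in finite dimension, the vectors selected by [get]
   in [adjoint] and [grad] exist and are unique (for linear A). *)
Lemma riesz (phi : V -> R) : scalar phi ->
  exists! v, forall u, ipV v u = phi u.
Proof.
have ips v : scalar (ipV v) by move=> a u w; rewrite linearPr.
have step (s : seq V) : forall psi, scalar psi -> exists v : V,
    (forall e, e \in s -> ipV v e = psi e) /\
    (forall chi : V -> R, scalar chi -> (forall e, e \in s -> chi e = 0) ->
       chi v = 0).
  elim: s => [|e0 s IH] psi lpsi.
    exists 0; split=> [e1|chi lchi _]; first by rewrite in_nil.
    by have := lchi (-1) 0 0; rewrite scaler0 addr0 mulN1r addNr.
  have [p [pE pspan]] := IH _ (ips e0).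
  have [v [vE vspan]] := IH _ lpsi.
  have sB (chi : V -> R) : scalar chi -> forall a u, chi (a - u) = chi a - chi u.
    by move=> lchi a u; rewrite -scaleN1r addrC lchi mulN1r addrC.
  have sZD (chi : V -> R) : scalar chi -> forall a u w,
      chi (w + a *: u) = chi w + a * chi u.
    by move=> lchi a u w; rewrite addrC lchi addrC.
  pose w := e0 - p.
  have ws e : e \in s -> ipV w e = 0.
    by move=> es; rewrite linearBl /= pE// subrr.
  have wp : ipV w p = 0 by apply: pspan.
  have we0 : ipV w e0 = ipV w w by rewrite [in RHS]/w linearBr /= wp subr0.
  have [w0|w0] := eqVneq w 0.
    have e0p : e0 = p by apply/eqP; rewrite -subr_eq0; exact/eqP.
    exists v; split=> [e1|chi lchi chi0].
      rewrite inE => /predU1P[->|/vE//]; rewrite e0p; apply/eqP.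
      rewrite -subr_eq0; apply/eqP.
      apply: (pspan (fun u => ipV v u - psi u)) => [a x y|e es].
        by rewrite (ips v) lpsi /= mulrBr opprD addrACA.
      by rewrite vE// subrr.
    by apply: vspan => // e es; apply: chi0; rewrite inE es orbT.
  have ww0 : ipV w w != 0 by rewrite gt_eqF// neq0_dnorm_gt0.
  pose c := (psi e0 - ipV v e0) / ipV w w.
  exists (v + c *: w); split=> [e1|chi lchi chi0].
    rewrite linearDl linearZl_LR /= inE => /predU1P[->|es].
      by rewrite we0 /c divfK// addrCA subrr addr0.
    by rewrite ws// mulr0 addr0 vE.
  have chis e : e \in s -> chi e = 0 by move=> es; rewrite chi0// inE es orbT.
  by rewrite sZD// sB// vspan// pspan// chi0 ?mem_head// subrr mulr0 addr0.
move=> lphi; have [n [b bspan]] := finV.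
have [v [vE _]] := step [seq b i | i <- enum 'I_n] _ lphi.
have key u : ipV v u = phi u.
  have [c ->] := bspan u; elim/big_rec : _ => [|i x _ IH].
    by rewrite linear0r; have := lphi (-1) 0 0;
       rewrite scaler0 addr0 mulN1r addNr.
  by rewrite lphi linearPr /= IH vE// map_f// mem_enum.
exists v; split=> // v' v'E; apply/eqP; rewrite -subr_eq0; apply: contraT.
by move/(neq0_dnorm_gt0 (s := ipV)); rewrite linearBl /= key v'E subrr ltxx.
Qed.

Lemma adjointP (A : {linear V -> W}) (v : V) (w : W) :
  ipV (adjoint A w) v = ipW w (A v).
Proof.
have [|u [uE _]] := riesz (phi := fun u => ipW w (A u)).
  by move=> a x y; rewrite linearP linearPr.
have ex : exists v', [set v' | forall u', ipV v' u' = ipW w (A u')] v' by exists u.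
exact: (getPex ex).
Qed.

Lemma gradP (h : V -> R) (x u : V) : ipV (grad h x) u = 'd h x u.
Proof.
have [|v [vE _]] := riesz (phi := 'd h x).
  by move=> a y z; rewrite linearP.
have ex : exists v', [set v' | forall u', ipV v' u' = 'd h x u'] v' by exists v.
exact: (getPex ex).
Qed.

End gradient.

Section kkt.
Context {R : realType} {X Y : normedModType R}.
Variables (ipX : inner_product X) (ipY : inner_product Y).
Variables (f : X -> R) (g : X -> Y) (K : set Y).

Definition lagrangian (x : X) (lambda : Y) : R := f x + ipY lambda (g x).

Definition grad_lagrangian (x : X) (lambda : Y) : X :=
  grad ipX (fun x' => lagrangian x' lambda) x.

Definition S_KKT (p : X * Y) : set (X * Y) :=
  [set z | grad_lagrangian z.1 z.2 = p.1 /\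
           normal_cone ipY K (g z.1 - p.2) z.2].

Definition X_KKT (p : X * Y) : set X :=
  [set x | exists lambda, S_KKT p (x, lambda)].

Definition multipliers (q : X * X * Y) : set Y :=
  let: (x, a, b) := q in [set lambda | S_KKT (a, b) (x, lambda)].

Definition strongly_calm (x0 : X) (lambda0 : Y) : Prop :=
  exists delta eps kappa : R, [/\ 0 < delta, 0 < eps, 0 < kappa &
    forall p, cball (prod_dot ipX ipY) (0, 0) delta p ->
    forall x lambda,
      (S_KKT p `&` cball (prod_dot ipX ipY) (x0, lambda0) eps) (x, lambda) ->
      dnorm ipX (x - x0) + dist ipY lambda (multipliers (x0, 0, 0))
        <= kappa * dnorm (prod_dot ipX ipY) p].

Definition pseudo_isolated_calm (x0 : X) (lambda0 : Y) : Prop :=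
  exists eps delta kappa : R, [/\ 0 < eps, 0 < delta, 0 < kappa &
    forall p, dnorm (prod_dot ipX ipY) p <= delta ->
    forall x lambda,
      (S_KKT p `&` cball (prod_dot ipX ipY) (x0, lambda0) eps) (x, lambda) ->
      dnorm ipX (x - x0) <= kappa * dnorm (prod_dot ipX ipY) p].

End kkt.

Lemma inner_product_continuous (R : realType) (Y : normedModType R)
    (ipY : inner_product Y) (lambda : Y) :
  norm_induced_by ipY -> continuous (ipY lambda : Y -> R).
Proof.
move=> normY.
have ge0 y : 0 <= ipY y y.
  have [->|y0] := eqVneq y 0; first by rewrite linear0r.
  exact/ltW/neq0_dnorm_gt0.
have cs y : ipY lambda y ^+ 2 <= ipY lambda lambda * ipY y y.
  have [->|l0] := eqVneq lambda 0; first by rewrite linear0l expr0n /= linear0l mul0r.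
  have d0 : 0 < ipY lambda lambda by exact: neq0_dnorm_gt0.
  set d := ipY lambda lambda in d0 *.
  have := ge0 (d *: y - ipY lambda y *: lambda).
  rewrite linearBl !linearBr /= !linearZl_LR !linearZr_LR /= -/d.
  rewrite [ipY y lambda]hermC expr0 mul1r /=.
  set l := ipY lambda y => h.
  rewrite -subr_ge0 -(pmulr_rge0 _ d0); apply: le_trans h _.
  suff -> : d * (d * ipY y y - l ^+ 2) =
      d * (d * ipY y y) - l * (d * l) - (d * (l * l) - l * (l * d)) by [].
  by ring.
have bound y : `|ipY lambda y| <= dnorm ipY lambda * `|y|.
  by rewrite normY /dnorm -sqrtrM// -sqrtr_sqr ler_wsqrtr.
have p0 : 0 < dnorm ipY lambda + 1 by rewrite ltr_wpDl// sqrtr_ge0.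
move=> y; apply/cvgrPdist_le => e e0; near=> z.
rewrite -linearBr (le_trans (bound _))//.
apply: (@le_trans _ _ ((dnorm ipY lambda + 1) * `|y - z|)).
  by rewrite ler_wpM2r// lerDl.
rewrite -ler_pdivlMl//; near: z.
apply: (cvgr_dist_le id); first exact: cvg_id.
by rewrite mulr_gt0// invr_gt0.
Unshelve. all: by end_near. Qed.

Lemma grad_lagrangianE (R : realType) (X Y : normedModType R)
    (ipX : inner_product X) (ipY : inner_product Y) (f : X -> R) (g : X -> Y)
    (x : X) (lambda : Y) :
  finite_dimensional X -> norm_induced_by ipY ->
  differentiable f x -> differentiable g x ->
  grad_lagrangian ipX ipY f g x lambda
    = grad ipX f x + nabla ipX ipY g x lambda.
Proof.
move=> finX normY df dg.
have cont := @inner_product_continuous _ _ ipY lambda normY.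
pose phi : {linear Y -> R^o} := HB.pack (ipY lambda : Y -> R^o)
  (GRing.isLinear.Build _ _ _ _ (ipY lambda : Y -> R^o)
     (fun a u v => linearPr ipY lambda a u v)).
have dphi y : differentiable phi y by exact: linear_differentiable.
have [|v [_ v_uniq]] :=
    riesz ipX finX (phi := 'd (fun z => lagrangian ipY f g z lambda) x).
  by move=> a y z; rewrite linearP.
rewrite -(v_uniq (grad_lagrangian ipX ipY f g x lambda)); last first.
  by move=> u; rewrite gradP.
apply: v_uniq => u.
have -> : (fun z => lagrangian ipY f g z lambda) = f + (phi \o g) by [].
have dphig : 'd (phi \o g) x = phi \o 'd g x :> (X -> R^o).
  by rewrite diff_comp// (diff_lin (f := phi)).
rewrite diffD//; last exact: differentiable_comp.
rewrite (linearDl ipX u) [LHS]/= gradP// adjointP//.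
by rewrite [RHS]/= dphig.
Qed.

(* Main.v *)
(** The calmness of the multiplier mapping is the bound on
    [dist lambda (multipliers (xbar, 0, 0))] by the norm of [(x - xbar, a, b)],
    up to an enlargement of the modulus because the infimum in [dist] need not be
    attained.  Strong calmness bounds the same distance by the norm of [(a, b)];
    the two norms are comparable once [x - xbar] is itself controlled by
    [(a, b)], which is pseudo-isolated calmness. *)

Require Import Defs.
From mathcomp Require Import all_boot all_order all_algebra.
From mathcomp Require Import lra.
From mathcomp Require Import all_classical all_reals all_analysis.
Import Order.TTheory GRing.Theory Num.Theory.
Import numFieldNormedType.Exports.

Local Open Scope classical_set_scope.
Local Open Scope ring_scope.

Section dnorm.
Context {R : realType} {V : lmodType R}.
Variable ipV : inner_product V.

Lemma inner_product_ge0 (v : V) : 0 <= ipV v v.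
Proof.
have [->|v0] := eqVneq v 0; first by rewrite linear0r.
exact/ltW/neq0_dnorm_gt0.
Qed.

Lemma dnorm_ge0 (v : V) : 0 <= dnorm ipV v.
Proof. exact: sqrtr_ge0. Qed.

Lemma dnorm_gt0 (v : V) : v != 0 -> 0 < dnorm ipV v.
Proof. by move=> v0; rewrite sqrtr_gt0 neq0_dnorm_gt0. Qed.

Lemma dnormZ (c : R) (v : V) : dnorm ipV (c *: v) = `|c| * dnorm ipV v.
Proof.
rewrite /dnorm linearZl_LR linearZr_LR /= mulrA -expr2.
by rewrite sqrtrM ?sqr_ge0// sqrtr_sqr.
Qed.

Lemma sqr_dnorm (v : V) : dnorm ipV v ^+ 2 = ipV v v.
Proof. by rewrite sqr_sqrtr// inner_product_ge0. Qed.

End dnorm.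

Section dnorm_prod.
Context {R : realType} {V W : lmodType R}.
Variables (ipV : inner_product V) (ipW : inner_product W).

Lemma dnorm_pair (p : V * W) : dnorm (prod_dot ipV ipW) p =
  Num.sqrt (dnorm ipV p.1 ^+ 2 + dnorm ipW p.2 ^+ 2).
Proof. by rewrite !sqr_dnorm. Qed.

Lemma dnorm_fst (p : V * W) : dnorm ipV p.1 <= dnorm (prod_dot ipV ipW) p.
Proof.
by rewrite ler_wsqrtr//= /prod_dot lerDl inner_product_ge0.
Qed.

Lemma dnorm_snd (p : V * W) : dnorm ipW p.2 <= dnorm (prod_dot ipV ipW) p.
Proof.
by rewrite ler_wsqrtr//= /prod_dot lerDr inner_product_ge0.
Qed.

(** After squaring, the two sides differ only by a nonnegative cross term. *)
Lemma dnorm_pair_le (p : V * W) :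
  dnorm (prod_dot ipV ipW) p <= dnorm ipV p.1 + dnorm ipW p.2.
Proof.
have n1 := dnorm_ge0 ipV p.1; have n2 := dnorm_ge0 ipW p.2.
rewrite dnorm_pair -[leRHS]ger0_norm ?addr_ge0// -sqrtr_sqr ler_wsqrtr//.
by nra.
Qed.

End dnorm_prod.

(** [multipliers] takes its argument as [(x, a, b)] with [x] and [a] grouped first, while the
    estimates separate [x] from the parameter [(a, b)]. *)
Lemma dnorm_prodA (R : realType) (U V W : lmodType R) (ipU : inner_product U)
    (ipV : inner_product V) (ipW : inner_product W) (u : U) (v : V) (w : W) :
  dnorm (prod_dot (prod_dot ipU ipV) ipW) (u, v, w) =
  dnorm (prod_dot ipU (prod_dot ipV ipW)) (u, (v, w)).
Proof. by rewrite /dnorm /= /prod_dot /= addrA. Qed.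

Section dist.
Context {R : realType} {V : lmodType R}.
Variable ip : inner_product V.

Lemma dist_ge0 (v : V) (A : set V) : 0 <= dist ip v A.
Proof.
(* For empty [A] the infimum takes its default value 0. *)
have [->|A0] := eqVneq A set0; first by rewrite /dist image_set0 inf0.
apply: lb_le_inf => [|_ [w _ <-]]; last exact: dnorm_ge0.
by move/set0P: A0 => -[w Aw]; exists (dnorm ip (v - w)), w.
Qed.

Lemma dist_le (v w : V) (A : set V) : A w -> dist ip v A <= dnorm ip (v - w).
Proof.
move=> Aw; apply: ge_inf; last by exists w.
by exists 0 => _ [u _ <-]; exact: dnorm_ge0.
Qed.

Lemma dist_lt (v : V) (A : set V) (r : R) : A !=set0 -> dist ip v A < r ->
  exists2 w, A w & dnorm ip (v - w) < r.
Proof.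
move=> [a Aa] /inf_lt[|_ [w Aw <-] ltr]; last by exists w.
by exists (dnorm ip (v - a)), a.
Qed.

(** The unit-ball vector is [v - w] divided by [r], hence the strict positivity of [r]. *)
Lemma mem_enlargement (A : set V) (v w : V) (r : R) : 0 < r -> A w ->
  dnorm ip (v - w) <= r ->
  [set w + r *: e | w in A & e in cball ip 0 1] v.
Proof.
move=> r0 Aw vw; exists w => //; exists (r^-1 *: (v - w)).
  by rewrite /cball /= subr0 dnormZ gtr0_norm ?invr_gt0// ler_pdivrMl// mulr1.
by rewrite scalerA divff ?gt_eqF// scale1r addrC subrK.
Qed.

Lemma dist_enlargement (A : set V) (v : V) (r : R) : 0 <= r ->
  [set w + r *: e | w in A & e in cball ip 0 1] v -> dist ip v A <= r.
Proof.
move=> r0 [w Aw [e]]; rewrite /cball /= subr0 => e1 <-.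
apply: (le_trans (dist_le _ _ _ Aw)).
by rewrite addrAC subrr add0r dnormZ ger0_norm// ler_piMr.
Qed.

End dist.

Section kkt_calmness.
Context {R : realType} {X Y : normedModType R}.
Variables (ipX : inner_product X) (ipY : inner_product Y).
Variables (f : X -> R) (g : X -> Y) (K : set Y) (xbar : X) (lbar : Y).

Let nXY := dnorm (prod_dot ipX ipY).
Let nXXY := dnorm (prod_dot (prod_dot ipX ipX) ipY).

Lemma strongly_calm_pseudo_isolated :
  strongly_calm ipX ipY f g K xbar lbar ->
  pseudo_isolated_calm ipX ipY f g K xbar lbar.
Proof.
move=> [d [e [k [d0 e0 k0 H]]]]; exists e, d, k; split=> // p pd x l xl.
have pb : cball (prod_dot ipX ipY) (0, 0) d p by rewrite /cball /= subr0.
by apply: le_trans (H p pb x l xl); rewrite lerDl dist_ge0.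
Qed.

Lemma strongly_calm_multipliers : S_KKT ipX ipY f g K (0, 0) (xbar, lbar) ->
  strongly_calm ipX ipY f g K xbar lbar ->
  calm (prod_dot (prod_dot ipX ipX) ipY) ipY (multipliers ipX ipY f g K)
    (xbar, 0, 0) lbar.
Proof.
move=> kkt [d [e [k [d0 e0 k0 H]]]].
have e20 : 0 < e / 2 by rewrite divr_gt0.
(* Bounds of [e / 2] on both [x - xbar] and [l - lbar] put [(x, l)] in the ball of radius [e]; the
   bound [d] serves the parameter. The extra 1 in the modulus creates a strict inequality below. *)
exists (k + 1), (Num.min d (e / 2)), (e / 2); split=> //.
- by rewrite addr_gt0.
- by rewrite lt_min d0.
move=> [[x a] b]; rewrite /cball /= le_min => /andP[zd ze] l [/= Sl le].
(* At the base point the enlargement has radius 0, but there [l] is itself a multiplier. *)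
have [z0|z0] := eqVneq ((x, a, b) - (xbar, 0, 0)) 0.
  move/eqP: (z0); rewrite subr_eq0 => /eqP[xE aE bE].
  exists l; first by rewrite -xE -{1}aE -bE.
  exists 0; last by rewrite scaler0 addr0.
  by rewrite /= subr0 -(scale0r 0) dnormZ normr0 mul0r.
have zE : (x, a, b) - (xbar, 0, 0) = (x - xbar, a, b).
  by rewrite -[LHS]/(x - xbar, a - 0, b - 0) !subr0.
have n0 := dnorm_gt0 (prod_dot (prod_dot ipX ipX) ipY) _ z0.
rewrite zE in zd ze n0 *.
have abz : nXY (a, b) <= nXXY (x - xbar, a, b).
  by rewrite /nXXY dnorm_prodA (dnorm_snd ipX (prod_dot ipX ipY) (_, (a, b))).
have xz : dnorm ipX (x - xbar) <= nXXY (x - xbar, a, b).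
  by rewrite /nXXY dnorm_prodA (dnorm_fst ipX (prod_dot ipX ipY) (_, (a, b))).
have pb : cball (prod_dot ipX ipY) (0, 0) d (a, b).
  by rewrite /cball /= subr0; exact: le_trans abz zd.
have xlb : cball (prod_dot ipX ipY) (xbar, lbar) e (x, l).
  rewrite /cball /=; apply: (le_trans (dnorm_pair_le _ _ _)) => /=.
  rewrite (splitr e) lerD//; exact: le_trans xz ze.
(* A radius strictly above the distance yields an actual multiplier [w]; strictness comes from [n0],
   and [lbar] shows that the multiplier set is nonempty. *)
have [||w Mw lw] := dist_lt ipY l
    (multipliers ipX ipY f g K (xbar, 0, 0)) ((k + 1) * nXXY (x - xbar, a, b)).
- by exists lbar.
- apply: (@le_lt_trans _ _ (k * nXY (a, b))).
    apply: le_trans (H _ pb x l (conj Sl xlb)).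
    by rewrite lerDr dnorm_ge0.
  by rewrite mulrDl mul1r ltr_pwDr// ler_wpM2l// ltW.
by apply: mem_enlargement Mw (ltW lw); rewrite mulr_gt0// addr_gt0.
Qed.

Lemma pseudo_isolated_multipliers_strongly_calm :
  pseudo_isolated_calm ipX ipY f g K xbar lbar ->
  calm (prod_dot (prod_dot ipX ipX) ipY) ipY (multipliers ipX ipY f g K)
    (xbar, 0, 0) lbar ->
  strongly_calm ipX ipY f g K xbar lbar.
Proof.
move=> [e1 [d1 [k1 [e10 d10 k10 H1]]]] [k2 [e2 [d2 [k20 e20 d20 H2]]]].
have k110 : 0 < k1 + 1 by rewrite addr_gt0.
(* The factor [k1 + 1] bounds the norm of [(x - xbar, a, b)] by that of [(a, b)], so dividing [e2]
   by it keeps [(x, a, b)] where [H2] applies. In the modulus, [k1] pays for [x] and [k2 * (k1 + 1)]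
   for the distance to the multipliers. *)
exists (Num.min d1 (e2 / (k1 + 1))), (Num.min e1 d2), (k1 + k2 * (k1 + 1)).
split.
- by rewrite lt_min d10 divr_gt0.
- by rewrite lt_min e10.
- by rewrite addr_gt0// mulr_gt0.
move=> [a b]; rewrite /cball /= subr0 le_min => /andP[pd1 pe2] x l [Sl].
rewrite /= le_min => /andP[xle1 xld2].
have xp := H1 _ pd1 x l (conj Sl xle1).
have ld2 := le_trans (dnorm_snd ipX ipY ((x, l) - (xbar, lbar))) xld2.
have zE : (x, a, b) - (xbar, 0, 0) = (x - xbar, a, b).
  by rewrite -[LHS]/(x - xbar, a - 0, b - 0) !subr0.
(* Here [k1] comes from [xp] and the 1 from [(a, b)] itself. *)
have zp : nXXY (x - xbar, a, b) <= (k1 + 1) * nXY (a, b).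
  rewrite /nXXY dnorm_prodA mulrDl mul1r.
  by apply: (le_trans (dnorm_pair_le _ _ _)); rewrite lerD2r.
have ze2 : cball (prod_dot (prod_dot ipX ipX) ipY) (xbar, 0, 0) e2 (x, a, b).
  rewrite /cball /= zE; apply: (le_trans zp).
  by rewrite mulrC -ler_pdivlMr.
(* [Sl] also says that [l] is a multiplier at [(x, a, b)], so calmness of [multipliers] applies to
   it. *)
have := H2 _ ze2 l (conj Sl ld2); rewrite zE => /(dist_enlargement _ _ _ _) lM.
rewrite mulrDl lerD//; apply: le_trans (lM _) _.
  by rewrite mulr_ge0 ?dnorm_ge0// ltW.
by rewrite -mulrA ler_pM2l.
Qed.

End kkt_calmness.

Theorem theorem3p2 (R : realType) (X Y : normedModType R)
    (ipX : inner_product X) (ipY : inner_product Y)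
    (finX : finite_dimensional X) (finY : finite_dimensional Y)
    (normX : norm_induced_by ipX) (normY : norm_induced_by ipY)
    (f : X -> R) (g : X -> Y) (K : set Y)
    (C2f : C2_on setT f) (C2g : C2_on setT g)
    (K_nonempty : K !=set0) (K_closed : closed K) (K_convex : convex_set K)
    (K_reducible : C2_cone_reducible K)
    (xbar : X) (lbar : Y)
    (kkt : S_KKT ipX ipY f g K (0, 0) (xbar, lbar))
    (not_unique : multipliers ipX ipY f g K (xbar, 0, 0) <> [set lbar]) :
  strongly_calm ipX ipY f g K xbar lbar <->
  pseudo_isolated_calm ipX ipY f g K xbar lbar /\
  calm (prod_dot (prod_dot ipX ipX) ipY) ipY (multipliers ipX ipY f g K)
    (xbar, 0, 0) lbar.
Proof.
split=> [sc|[pic mc]]; last exact: pseudo_isolated_multipliers_strongly_calm.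
split; first exact: strongly_calm_pseudo_isolated.
exact: strongly_calm_multipliers.
Qed.
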